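(* Let $B$ be a 3-Lie algebra over $\mathbb F$ and let $(W,\rho)$ be a 3-Lie algebra $B$-module such that $Z(L_\rho(W))=0$. Then $(W,\bar\rho)$ is a module of the Lie algebra $\mathrm{ad}(B)$, where $\bar\rho:\mathrm{ad}(B)\to gl(W)$ is the $\mathbb F$-linear map defined by $\bar\rho(\mathrm{ad}(x,y))=\rho(x,y)$ for all $x,y\in B$.
   Context: $\mathbb F$ is a field of characteristic zero; all vector spaces and algebras are over $\mathbb F$. A 3-Lie algebra is a vector space $B$ with a linear map $[\,,\,,\,]:B\wedge B\wedge B\to B$ satisfying $[x_1,x_2,[x_3,x_4,x_5]]=[[x_1,x_2,x_3],x_4,x_5]+[x_3,[x_1,x_2,x_4],x_5]+[x_3,x_4,[x_1,x_2,x_5]]$ for all $x_i\in B$. For $x,y\in B$ the left multiplication $\mathrm{ad}(x,y):B\to B$ is $\mathrm{ad}(x,y)(z)=[x,y,z]$. The inner derivation algebra $\mathrm{ad}(B)$ is the set of all linear combinations of left multiplications; it is a Lie algebra under the commutator. A module of a 3-Lie algebra $B$ is a pair $(W,\rho)$, where $W$ is a vector space and $\rho:B\wedge B\to gl(W)$ is linear, such that for all $x_1,x_2,x_3,x_4\in B$: $[\rho(x_1,x_2),\rho(x_3,x_4)]=\rho([x_1,x_2,x_3],x_4)+\rho(x_3,[x_1,x_2,x_4])$ and $\rho([x_1,x_2,x_3],x_4)=\rho(x_1,x_2)\rho(x_3,x_4)+\rho(x_2,x_3)\rho(x_1,x_4)+\rho(x_3,x_1)\rho(x_2,x_4)$.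 For a $B$-module $(W,\rho)$, $L_\rho(W)$ denotes the linear span of $\{\rho(x,y)\mid x,y\in B\}$, which is a Lie subalgebra of $gl(W)$, and $Z(L_\rho(W))$ denotes its center. When $Z(L_\rho(W))=0$, the map $\bar\rho$ in the claim is well defined. *)

(* Defs.v *)
From HB Require Import structures.
From mathcomp Require Import all_boot all_algebra.
From mathcomp Require Import boolp classical_sets.

Set Implicit Arguments.
Unset Strict Implicit.
Unset Printing Implicit Defensive.

Import GRing.Theory.
Local Open Scope ring_scope.
Local Open Scope classical_set_scope.

HB.mixin Record Lmodule_isLie (F : fieldType) L of GRing.Lmodule F L := {
  lie : L -> L -> L;
  lie_linearl : forall y, linear (fun x => lie x y);
  lie_linearr : forall x, linear (lie x);
  liexx : forall x, lie x x = 0;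
  lie_jacobi : forall x y z,
    lie x (lie y z) + lie y (lie z x) + lie z (lie x y) = 0
}.

#[short(type="lieType")]
HB.structure Definition Lie (F : fieldType) :=
  { L of GRing.Lmodule F L & Lmodule_isLie F L }.

(* A linear map on the third exterior power of B is an alternating trilinear
   map on B. *)
HB.mixin Record Lmodule_isThreeLie (F : fieldType) B of GRing.Lmodule F B := {
  lie3 : B -> B -> B -> B;
  lie3_linear1 : forall y z, linear (fun x => lie3 x y z);
  lie3_linear2 : forall x z, linear (fun y => lie3 x y z);
  lie3_linear3 : forall x y, linear (lie3 x y);
  lie3_alt12 : forall x z, lie3 x x z = 0;
  lie3_alt13 : forall x y, lie3 x y x = 0;
  lie3_alt23 : forall x y, lie3 x y y = 0;
  lie3_fundamental : forall x1 x2 x3 x4 x5,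
    lie3 x1 x2 (lie3 x3 x4 x5) =
      lie3 (lie3 x1 x2 x3) x4 x5 + lie3 x3 (lie3 x1 x2 x4) x5
      + lie3 x3 x4 (lie3 x1 x2 x5)
}.

#[short(type="threeLieType")]
HB.structure Definition ThreeLie (F : fieldType) :=
  { B of GRing.Lmodule F B & Lmodule_isThreeLie F B }.

Section LinearSpan.
Variables (F : fieldType) (V : lmodType F).

Definition lspan (S : set V) : set V :=
  [set v | exists (n : nat) (c : 'I_n -> F) (u : 'I_n -> V),
             (forall i, S (u i)) /\ v = \sum_(i < n) c i *: u i].

Lemma lspan_gen (S : set V) v : S v -> lspan S v.
Proof.
by move=> Sv; exists 1%N, (fun=> 1), (fun=> v); rewrite big_ord1 scale1r.
Qed.

Lemma lspan0 (S : set V) : lspan S 0.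
Proof.
by exists 0%N, (fun=> 0), (fun=> 0); split; [case | rewrite big_ord0].
Qed.

Lemma lspanP (S : set V) a u v : lspan S u -> lspan S v -> lspan S (a *: u + v).
Proof.
move=> [n [c [x [Sx ->]]]] [m [d [y [Sy ->]]]].
exists (n + m)%N,
  (fun i => match split i with inl j => a * c j | inr j => d j end),
  (fun i => match split i with inl j => x j | inr j => y j end); split.
  by move=> i; case: (split i).
rewrite big_split_ord scaler_sumr /=; congr (_ + _); apply: eq_bigr => i _.
  by rewrite (unsplitK (inl i)) scalerA.
by rewrite (unsplitK (inr i)).
Qed.

Lemma lspan_min (S T : set V) :
  T 0 -> (forall a u v, T u -> T v -> T (a *: u + v)) -> S `<=` T ->
  lspan S `<=` T.
Proof.
move=> T0 TP ST _ [n [c [x [Sx ->]]]].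
elim/big_rec: _ => [//|i v _ Tv]; apply: TP => //; exact: ST.
Qed.

End LinearSpan.

Section GeneralLinear.
Variables (F : fieldType) (W : lmodType F).

Definition gl : Type := {linear W -> W}.

HB.instance Definition _ := gen_eqMixin gl.
HB.instance Definition _ := gen_choiceMixin gl.

Implicit Types f g h : gl.

Lemma glP f g : (forall w, f w = g w) -> f = g.
Proof.
case: f => f [[fA] [fB]]; case: g => g [[gA] [gB]] /= fg.
have {}fg : f = g by apply: funext.
case: _ / fg in gA gB *.
by rewrite (Prop_irrelevance fA gA) (Prop_irrelevance fB gB).
Qed.

Definition gl_comp f g : gl := f \o g.
Definition gl_zero : gl := \0.
Definition gl_opp f : gl := \- f.
Definition gl_add f g : gl := f \+ g.

Definition gl_scale_fun (a : F) f (w : W) : W := a *: f w.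
Lemma gl_scale_linear a f : linear (gl_scale_fun a f).
Proof.
move=> b u v; rewrite /gl_scale_fun linearP scalerDr !scalerA.
by rewrite mulrC.
Qed.
HB.instance Definition _ a f :=
  GRing.isLinear.Build F W W *:%R (gl_scale_fun a f) (gl_scale_linear a f).
Definition gl_scale a f : gl := gl_scale_fun a f.

Let gl_addA : associative gl_add.
Proof. by move=> f g h; apply: glP => w /=; rewrite addrA. Qed.
Let gl_addC : commutative gl_add.
Proof. by move=> f g; apply: glP => w /=; rewrite addrC. Qed.
Let gl_add0 : left_id gl_zero gl_add.
Proof. by move=> f; apply: glP => w /=; rewrite add0r. Qed.
Let gl_addN : left_inverse gl_zero gl_opp gl_add.
Proof. by move=> f; apply: glP => w /=; rewrite addNr. Qed.

HB.instance Definition _ :=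
  GRing.isZmodule.Build gl gl_addA gl_addC gl_add0 gl_addN.

Let gl_scaleA a b f : gl_scale a (gl_scale b f) = gl_scale (a * b) f.
Proof. by apply: glP => w; exact: scalerA. Qed.
Let gl_scale1 : left_id 1 gl_scale.
Proof. by move=> f; apply: glP => w; exact: scale1r. Qed.
Let gl_scaleDr : right_distributive gl_scale +%R.
Proof. by move=> a f g; apply: glP => w; exact: scalerDr. Qed.
Let gl_scaleDl f : {morph gl_scale^~ f : a b / a + b}.
Proof. by move=> a b; apply: glP => w; exact: scalerDl. Qed.

HB.instance Definition _ :=
  GRing.Zmodule_isLmodule.Build F gl gl_scaleA gl_scale1 gl_scaleDr gl_scaleDl.

Definition gl_lie f g : gl := gl_comp f g - gl_comp g f.

Lemma gl_addE f g w : (f + g) w = f w + g w. Proof. by []. Qed.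
Lemma gl_oppE f w : (- f) w = - f w. Proof. by []. Qed.
Lemma gl_scaleE a f w : (a *: f) w = a *: f w. Proof. by []. Qed.
Lemma gl_lieE f g w : gl_lie f g w = f (g w) - g (f w). Proof. by []. Qed.

Let gl_lie_linearl g : linear (gl_lie ^~ g).
Proof.
move=> a f h; apply: glP => w.
by rewrite !(gl_addE, gl_scaleE, gl_lieE) linearP scalerBr opprD addrACA.
Qed.
Let gl_lie_linearr f : linear (gl_lie f).
Proof.
move=> a g h; apply: glP => w.
by rewrite !(gl_addE, gl_scaleE, gl_lieE) linearP scalerBr opprD addrACA.
Qed.
Let gl_liexx f : gl_lie f f = 0.
Proof. exact: subrr. Qed.
Let gl_lie_jacobi f g h :
  gl_lie f (gl_lie g h) + gl_lie g (gl_lie h f) + gl_lie h (gl_lie f g) = 0.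
Proof.
apply: glP => w; rewrite !(gl_addE, gl_lieE) (linearB f) (linearB g).
rewrite (linearB h) !opprB.
rewrite (AC (((2*2)*(2*2))*(2*2))
  ((((1*12)*(7*2))*((3*10)*(5*4)))*((11*6)*(9*8)))) /=.
by rewrite !subrr !addr0.
Qed.

HB.instance Definition _ := Lmodule_isLie.Build F gl
  gl_lie_linearl gl_lie_linearr gl_liexx gl_lie_jacobi.

End GeneralLinear.

Section LieTheory.
Variables (F : fieldType) (L : lieType F).

Lemma lie0l (y : L) : lie 0 y = 0.
Proof.
by have := lie_linearl y (-1) 0 0; rewrite !scaleN1r oppr0 addr0 addNr.
Qed.

Lemma lie0r (x : L) : lie x 0 = 0.
Proof.
by have := lie_linearr x (-1) 0 0; rewrite !scaleN1r oppr0 addr0 addNr.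
Qed.

Lemma lspan_lie (S : set L) :
  (forall s t, S s -> S t -> lspan S (lie s t)) ->
  forall x y, lspan S x -> lspan S y -> lspan S (lie x y).
Proof.
move=> Slie x y Sx Sy.
apply: (lspan_min (T := [set x | lspan S (lie x y)]) _ _ _ Sx) => /=.
- by rewrite lie0l; exact: lspan0.
- by move=> a u v Pu Pv; rewrite lie_linearl; exact: lspanP.
move=> s Ss /=.
apply: (lspan_min (T := [set y | lspan S (lie s y)]) _ _ _ Sy) => /=.
- by rewrite lie0r; exact: lspan0.
- by move=> a u v Pu Pv; rewrite lie_linearr; exact: lspanP.
by move=> t St; exact: Slie.
Qed.

Definition lie_center (S : set L) : set L :=
  [set z | S z /\ forall s, S s -> lie z s = 0].

End LieTheory.

Section InnerDerivations.
Variables (F : fieldType) (B : threeLieType F).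

HB.instance Definition _ (x y : B) :=
  GRing.isLinear.Build F B B *:%R (lie3 x y) (lie3_linear3 x y).

Definition ad (x y : B) : gl B := lie3 x y.

Definition inner_der : {pred gl B} :=
  fun D => `[< lspan [set ad x y | x in setT & y in setT] D >].

Lemma inner_derP D :
  reflect (lspan [set ad x y | x in setT & y in setT] D) (D \in inner_der).
Proof. exact: asboolP. Qed.

Let inner_der_submod : submod_closed inner_der.
Proof.
split=> [|a f g /inner_derP fP /inner_derP gP]; apply/inner_derP.
  exact: lspan0.
exact: lspanP.
Qed.
HB.instance Definition _ :=
  GRing.isSubmodClosed.Build F (gl B) inner_der inner_der_submod.

Record inner_derivation : Type :=
  InnerDerivation { inner_val :> gl B; _ : inner_val \in inner_der }.
HB.instance Definition _ := [isSub for inner_val].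
HB.instance Definition _ := [Choice of inner_derivation by <:].
HB.instance Definition _ := [SubChoice_isSubLmodule of inner_derivation by <:].

Lemma ad_inner x y : ad x y \in inner_der.
Proof. by apply/inner_derP/lspan_gen; exists x => //; exists y. Qed.

Definition inner_ad (x y : B) : inner_derivation :=
  InnerDerivation (ad_inner x y).

Lemma lie_ad x1 x2 x3 x4 :
  lie (ad x1 x2) (ad x3 x4) = ad (lie3 x1 x2 x3) x4 + ad x3 (lie3 x1 x2 x4).
Proof.
apply: glP => z; rewrite gl_addE gl_lieE /= lie3_fundamental.
by rewrite addrK.
Qed.

Lemma inner_der_lie (D E : gl B) :
  D \in inner_der -> E \in inner_der -> lie D E \in inner_der.
Proof.
move=> /inner_derP DP /inner_derP EP; apply/inner_derP.
apply: lspan_lie DP EP => _ _ [x1 _ [x2 _ <-]] [x3 _ [x4 _ <-]].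
by apply/inner_derP; rewrite lie_ad rpredD ?ad_inner.
Qed.

Definition inner_lie (D E : inner_derivation) : inner_derivation :=
  InnerDerivation (inner_der_lie (valP D) (valP E)).

Let inner_lie_linearl E : linear (inner_lie ^~ E).
Proof. by move=> a D D'; apply: val_inj; exact: lie_linearl. Qed.
Let inner_lie_linearr D : linear (inner_lie D).
Proof. by move=> a E E'; apply: val_inj; exact: lie_linearr. Qed.
Let inner_liexx D : inner_lie D D = 0.
Proof. by apply: val_inj; exact: liexx. Qed.
Let inner_lie_jacobi x y z :
  inner_lie x (inner_lie y z) + inner_lie y (inner_lie z x)
  + inner_lie z (inner_lie x y) = 0.
Proof. by apply: val_inj; exact: lie_jacobi. Qed.

HB.instance Definition _ := Lmodule_isLie.Build F inner_derivation
  inner_lie_linearl inner_lie_linearr inner_liexx inner_lie_jacobi.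

End InnerDerivations.

Definition lie_module (F : fieldType) (L : lieType F) (W : lmodType F)
    (r : L -> gl W) : Prop :=
  linear r /\ forall x y, r (lie x y) = lie (r x) (r y).

Section ThreeLieModules.
Variables (F : fieldType) (B : threeLieType F) (W : lmodType F).
Implicit Type rho : B -> B -> gl W.

Record three_lie_module rho : Prop := ThreeLieModule {
  rho_linearl : forall y, linear (rho ^~ y);
  rho_linearr : forall x, linear (rho x);
  rho_alt : forall x, rho x x = 0;
  rho_lie : forall x1 x2 x3 x4,
    lie (rho x1 x2) (rho x3 x4) =
      rho (lie3 x1 x2 x3) x4 + rho x3 (lie3 x1 x2 x4);
  rho_comp : forall x1 x2 x3 x4,
    rho (lie3 x1 x2 x3) x4 =
      gl_comp (rho x1 x2) (rho x3 x4) + gl_comp (rho x2 x3) (rho x1 x4)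
      + gl_comp (rho x3 x1) (rho x2 x4)
}.

Definition Lrho rho : set (gl W) :=
  lspan [set rho x y | x in setT & y in setT].

Lemma Lrho_lie rho : three_lie_module rho ->
  forall f g, Lrho rho f -> Lrho rho g -> Lrho rho (lie f g).
Proof.
move=> rhoP; apply: lspan_lie => _ _ [x1 _ [x2 _ <-]] [x3 _ [x4 _ <-]].
rewrite (rho_lie rhoP) -[rho (lie3 _ _ _) _]scale1r.
by apply: lspanP; apply: lspan_gen; [exists (lie3 x1 x2 x3) | exists x3] => //;
  [exists x4 | exists (lie3 x1 x2 x4)].
Qed.

End ThreeLieModules.

(* Main.v *)
Require Import Defs.
From HB Require Import structures.
From mathcomp Require Import all_boot all_algebra.
From mathcomp Require Import boolp classical_sets.

(** The formula [ad x y |-> rho x y] extends linearly exactly when every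
    relation [\sum_i c_i *: ad x_i y_i = 0] implies
    [\sum_i c_i *: rho x_i y_i = 0].  Write [D] and [R] for the two sums.
    Summing the first module axiom gives, for all [u] and [v],
      [lie R (rho u v) = rho (D u) v + rho u (D v)]   ([ad_rho_span_rho]),
    whose right-hand side depends on [D] only.  So [D = 0] makes [R] commute
    with every [rho u v], hence central in [Lrho rho], hence zero.

    The sums are handled all together through the linear relation
    [ad_rho_span rho], spanned by the pairs [(ad x y, rho x y)]: the argument
    above says that it is the graph of a function ([ad_rho_span_fun]), and
    this function is [rhobar].  It is linear because the graph is a subspace.
    The displayed identity, together with its analogue for [ad]
    ([ad_rho_span_ad]), shows that the graph is also closed under componentwise
    brackets ([ad_rho_span_lie]), so that [rhobar] preserves brackets. *)

Set Implicit Arguments.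
Unset Strict Implicit.
Unset Printing Implicit Defensive.

Import GRing.Theory.
Local Open Scope ring_scope.
Local Open Scope classical_set_scope.

Section AdRhoSpan.
Variables (F : fieldType) (B : threeLieType F) (W : lmodType F).
Variable rho : B -> B -> gl W.
Hypothesis rhoP : three_lie_module rho.

Definition ad_rho_span : set (gl B * gl W) :=
  lspan [set p | exists x y, p = (ad x y, rho x y)].

Lemma ad_rho_span_gen x y : ad_rho_span (ad x y, rho x y).
Proof. by apply: lspan_gen; exists x, y. Qed.

Lemma ad_rho_spanP a D R E S : ad_rho_span (D, R) -> ad_rho_span (E, S) ->
  ad_rho_span (a *: D + E, a *: R + S).
Proof. by move=> DR ES; exact: (lspanP a DR ES). Qed.

Lemma ad_rho_span_ind (T : gl B -> gl W -> Prop) :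
  T 0 0 ->
  (forall a D R E S, T D R -> T E S -> T (a *: D + E) (a *: R + S)) ->
  (forall x y, T (ad x y) (rho x y)) ->
  forall D R, ad_rho_span (D, R) -> T D R.
Proof.
move=> T0 TP Tgen D R DR.
apply: (lspan_min (T := [set p | T p.1 p.2]) _ _ _ DR) => //=.
- by move=> a [D1 R1] [D2 R2]; exact: TP.
by move=> _ [x [y ->]] /=.
Qed.

Lemma ad_linearl y : linear (fun x : B => ad x y).
Proof. by move=> a u v; apply: glP => z; exact: lie3_linear1. Qed.

Lemma ad_linearr (x : B) : linear (ad x).
Proof. by move=> a u v; apply: glP => z; exact: lie3_linear2. Qed.

Lemma linear0_fun (U V : lmodType F) (f : U -> V) : linear f -> f 0 = 0.
Proof.
by move=> fP; have := fP (-1) 0 0; rewrite !scaleN1r oppr0 addr0 addNr.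
Qed.

(** Both sides are linear in the pair [(D, R)], so the module axiom, which is
    the case of a generating pair, implies the general one. *)
Lemma ad_rho_span_rho D R : ad_rho_span (D, R) ->
  forall u v, lie R (rho u v) = rho (D u) v + rho u (D v).
Proof.
move=> DR u v; elim/ad_rho_span_ind: DR => {D R} [|a D R E S IHD IHE|x y].
- rewrite lie0l (linear0_fun (rho_linearl rhoP v)).
  by rewrite (linear0_fun (rho_linearr rhoP u)) addr0.
- rewrite lie_linearl IHD IHE !gl_addE !gl_scaleE.
  rewrite (rho_linearl rhoP v) (rho_linearr rhoP u) scalerDr.
  by rewrite addrACA.
exact: rho_lie.
Qed.

(** Same reason as for [rho]: an inner derivation is a linear combination of
    maps [ad x y], each a derivation by the fundamental identity. *)
Lemma ad_rho_span_ad D R : ad_rho_span (D, R) ->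
  forall u v, lie D (ad u v) = ad (D u) v + ad u (D v).
Proof.
move=> DR u v; elim/ad_rho_span_ind: DR => {D R} [|a D R E S IHD IHE|x y].
- rewrite lie0l (linear0_fun (ad_linearl v)).
  by rewrite (linear0_fun (ad_linearr u)) addr0.
- rewrite lie_linearl IHD IHE !gl_addE !gl_scaleE.
  by rewrite (ad_linearl v) (ad_linearr u) scalerDr addrACA.
exact: lie_ad.
Qed.

(** By linearity in [(E, S)] it is enough to bracket with a generating pair
    [(ad u v, rho u v)]; the two derivation identities then give the sum of the
    generating pairs at [(D u, v)] and [(u, D v)]. *)
Lemma ad_rho_span_lie D R E S : ad_rho_span (D, R) -> ad_rho_span (E, S) ->
  ad_rho_span (lie D E, lie R S).
Proof.
move=> DR; elim/ad_rho_span_ind => {E S} [|a E S E' S' IHE IHE'|u v].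
- by rewrite !lie0r; exact: lspan0.
- by rewrite !lie_linearr; exact: ad_rho_spanP.
rewrite (ad_rho_span_ad DR) (ad_rho_span_rho DR).
rewrite -[ad (D u) v]scale1r -[rho (D u) v]scale1r.
by apply: ad_rho_spanP; exact: ad_rho_span_gen.
Qed.

Lemma ad_rho_span_Lrho D R : ad_rho_span (D, R) -> Lrho rho R.
Proof.
elim/ad_rho_span_ind => {D R} [|a D R E S|x y]; first exact: lspan0.
  exact: lspanP.
by apply: lspan_gen; exists x => //; exists y.
Qed.

Lemma ad_rho_span_total D : D \in @inner_der F B -> exists R, ad_rho_span (D, R).
Proof.
move=> /inner_derP.
apply: (lspan_min (T := [set D | exists R, ad_rho_span (D, R)])) => /=.
- by exists 0; exact: lspan0.
- by move=> a D' E [R DR] [S ES]; exists (a *: R + S); exact: ad_rho_spanP.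
by move=> _ [x _ [y _ <-]]; exists (rho x y); exact: ad_rho_span_gen.
Qed.

(** An [R] paired with [0] commutes with all [rho u v] by [ad_rho_span_rho],
    so it is central. *)
Lemma ad_rho_span0 R : lie_center (Lrho rho) = [set 0] ->
  ad_rho_span (0, R) -> R = 0.
Proof.
move=> Z0 OR; suff : lie_center (Lrho rho) R by rewrite Z0.
split=> [|S LS]; first exact: ad_rho_span_Lrho OR.
apply: (lspan_min (T := [set S | lie R S = 0]) _ _ _ LS) => /=.
- exact: lie0r.
- by move=> a f g Rf Rg; rewrite lie_linearr Rf Rg scaler0 addr0.
move=> _ [u _ [v _ <-]] /=; rewrite (ad_rho_span_rho OR).
rewrite (linear0_fun (rho_linearl rhoP v)).
by rewrite (linear0_fun (rho_linearr rhoP u)) addr0.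
Qed.

Lemma ad_rho_span_fun D R S : lie_center (Lrho rho) = [set 0] ->
  ad_rho_span (D, R) -> ad_rho_span (D, S) -> R = S.
Proof.
move=> Z0 DR DS; apply/esym/subr0_eq/(ad_rho_span0 Z0).
have := ad_rho_spanP (-1) DR DS.
by rewrite !scaleN1r addNr addrC.
Qed.

End AdRhoSpan.

Theorem theorem3p3 (F : fieldType) (charF : [pchar F] =i pred0)
    (B : threeLieType F) (W : lmodType F) (rho : B -> B -> gl W)
    (rhoP : three_lie_module rho)
    (Z0 : lie_center (Lrho rho) = [set 0]) :
  exists rhobar : {linear inner_derivation B -> gl W},
    [/\ forall x y : B, rhobar (inner_ad x y) = rho x y,
        forall r : {linear inner_derivation B -> gl W},
          (forall x y : B, r (inner_ad x y) = rho x y) -> r =1 rhobar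
      & lie_module rhobar].
Proof.
have [f fP] := choice (fun D : inner_derivation B =>
  ad_rho_span_total rho (valP D)).
have fE D R : ad_rho_span rho (val D, R) -> f D = R.
  exact: ad_rho_span_fun (fP D).
have f_linear : linear f.
  by move=> a D E; apply: fE; exact: ad_rho_spanP.
pose fL := GRing.isLinear.Build F (inner_derivation B) (gl W) *:%R f f_linear.
pose rhobar : {linear inner_derivation B -> gl W} := HB.pack f fL.
exists rhobar; split=> [x y|r rE D|].
- by apply: fE; exact: ad_rho_span_gen.
- (* The graph of [r] contains the generating pairs, hence the whole relation,
     hence the graph of [f]. *)
  suff rgraph E R : ad_rho_span rho (E, R) ->
      exists2 D' : inner_derivation B, val D' = E & r D' = R.
    by have [D' /val_inj -> ->] := rgraph _ _ (fP D).
  elim/ad_rho_span_ind => {E R} [|a E R E' R' [D1 <- <-] [D2 <- <-]|x y].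
  + by exists 0; rewrite ?linear0.
  + by exists (a *: D1 + D2); rewrite ?linearP.
  by exists (inner_ad x y).
split=> [|D E]; first exact: f_linear.
by apply: fE; exact: ad_rho_span_lie.
Qed.
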